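(* Let $s\in\mathbb{C}$ and let $n$ be a positive integer. Then $$\sum_{k=1}^n\left\{\frac{\zeta_k^2(s)}{k^s}-\frac{\zeta_k(s)}{k^{2s}}\right\}=\frac{\zeta_n^3(s)-\zeta_n(3s)}{3}.$$
   Context: For a positive integer $m$ and $s\in\mathbb{C}$, $\zeta_m(s)=\sum_{j=1}^m j^{-s}$ denotes the truncated zeta sum, and $\zeta_m^r(s)=(\zeta_m(s))^r$. *)

(* Defs.v *)
From Stdlib Require Import Reals.
From Coquelicot Require Import Coquelicot.

Definition Cexp (z : C) : C :=
  (RtoC (exp (Re z)) * (cos (Im z), sin (Im z)))%C.

(* k^s with the real logarithm of k; meaningful only for k >= 1, since
   [ln 0 = 0] makes [nat_Cpower 0 s] equal to 1. *)
Definition nat_Cpower (k : nat) (s : C) : C := Cexp (s * RtoC (ln (INR k)))%C.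

Definition zeta_trunc (m : nat) (s : C) : C :=
  sum_n_m (G := C_AbelianMonoid) (fun j : nat => nat_Cpower j (- s)%C) 1 m.

(* Main.v *)
Require Import Defs.
From Stdlib Require Import Reals Lia.
From Coquelicot Require Import Coquelicot.

(** With [a] the last summand of [zeta_{n+1}(s)] and [Z = zeta_n(s)], both
    sides increase from [n] to [n + 1] by
    [(Z + a)^2 a - (Z + a) a^2 = Z^2 a + Z a^2 = ((Z + a)^3 - Z^3 - a^3) / 3]. *)

(** The proof is by induction on [n]. The law [Cexp_add] turns every power of [n + 1] that occurs
    into a power of the single quantity [a]: dividing by [(n + 1)^s] or [(n + 1)^(2s)] is
    multiplying by [a] or [a^2], and the new term of [zeta_{n+1}(3s)] is [a^3]. The increment is
    then a polynomial identity in [Z] and [a]. *)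

Lemma Cexp_add (z w : C) : Cexp (z + w)%C = (Cexp z * Cexp w)%C.
Proof.
  destruct z as [a b], w as [c d].
  unfold Cexp, Cplus, Cmult, RtoC; simpl.
  rewrite exp_plus, cos_plus, sin_plus.
  apply injective_projections; simpl; ring.
Qed.

Lemma Cexp_0 : Cexp 0%C = 1%C.
Proof.
  unfold Cexp, Cmult, RtoC; simpl.
  rewrite exp_0, cos_0, sin_0.
  apply injective_projections; simpl; ring.
Qed.

Lemma Cexp_mul_opp (z : C) : (Cexp z * Cexp (- z))%C = 1%C.
Proof. now rewrite <- Cexp_add, Cplus_opp_r, Cexp_0. Qed.

Lemma Cexp_neq_0 (z : C) : Cexp z <> 0%C.
Proof.
  intros H; generalize (Cexp_mul_opp z); rewrite H, Cmult_0_l.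
  intros E; symmetry in E; revert E; exact C1_nz.
Qed.

Lemma nat_Cpower_add (k : nat) (s t : C) :
  nat_Cpower k (s + t)%C = (nat_Cpower k s * nat_Cpower k t)%C.
Proof. unfold nat_Cpower; now rewrite Cmult_plus_distr_r, Cexp_add. Qed.

(** Links the divisions in the summand to the negative exponents inside [zeta_trunc]. *)
Lemma nat_Cpower_opp (k : nat) (s : C) :
  nat_Cpower k (- s)%C = (/ nat_Cpower k s)%C.
Proof.
  unfold nat_Cpower.
  replace (- s * RtoC (ln (INR k)))%C with (- (s * RtoC (ln (INR k))))%C by ring.
  set (z := (s * RtoC (ln (INR k)))%C).
  rewrite <- (Cmult_1_l (/ Cexp z)%C), <- (Cexp_mul_opp z).
  field; apply Cexp_neq_0.
Qed.

Lemma zeta_trunc_0 (s : C) : zeta_trunc 0 s = 0%C.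
Proof. unfold zeta_trunc; now rewrite sum_n_m_zero by lia. Qed.

Lemma zeta_trunc_S (m : nat) (s : C) :
  zeta_trunc (S m) s = (zeta_trunc m s + nat_Cpower (S m) (- s))%C.
Proof. unfold zeta_trunc; now rewrite sum_n_Sm by lia. Qed.

Theorem mainTheorem2 : forall (s : C) (n : nat), (0 < n)%nat ->
  sum_n_m (G := C_AbelianMonoid)
    (fun k : nat =>
       (zeta_trunc k s ^ 2 / nat_Cpower k s
        - zeta_trunc k s / nat_Cpower k (2 * s))%C) 1 n
  = ((zeta_trunc n s ^ 3 - zeta_trunc n (3 * s)) / 3)%C.
Proof.
  assert (three_neq_0 : RtoC 3 <> 0%C).
  { intros E; apply RtoC_inj in E; revert E; apply eq_IZR_contrapositive; lia. }
  intros s n _; induction n as [|n IH].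
  - rewrite sum_n_m_zero, !zeta_trunc_0 by lia.
    change (RtoC 0 = ((0 ^ 3 - 0) / 3)%C); field; exact three_neq_0.
  - rewrite sum_n_Sm, IH by lia.
    change (@plus C_AbelianMonoid) with Cplus.
    (* The equality is still typed in the carrier of [C_AbelianMonoid]; [ring] and [field] need it
       over [C]. *)
    match goal with |- ?l = ?r => change (@eq C l r) end.
    rewrite !zeta_trunc_S.
    replace (2 * s)%C with (s + s)%C by ring.
    replace (- (3 * s))%C with (- s + - s + - s)%C by ring.
    (* Occurrences 2 and 3 are the quotients of the new summand; the divisions by 3 stay. *)
    unfold Cdiv at 2 3.
    rewrite <- !nat_Cpower_opp.
    replace (- (s + s))%C with (- s + - s)%C by ring.
    rewrite !nat_Cpower_add.
    field; exact three_neq_0.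
Qed.
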